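(* For every $\varepsilon>0$ there is a constant $C(\varepsilon)>0$, depending only on $\varepsilon$, such that the following holds. Let $N$ be a positive integer, let $\alpha$ be a real number, and let $a,q$ be coprime integers with $q\ge 1$ and $|\alpha q-a|\le q^{-1}$. Then \[ |S(\alpha)|\le C(\varepsilon)\left(N^{1+\varepsilon}q^{-1}+N^{\varepsilon}q\right). \]
   Context: Here $\mu$ is the Möbius function, $e(x)=e^{2\pi i x}$, and \[ S(\alpha)=\sum_{n\le N}\mu^2(n)\,e(\alpha n), \] the exponential sum over squarefree integers up to $N$. *)

(* Defs.v *)
From mathcomp Require Export all_boot all_order all_algebra.
From mathcomp Require Export complex.
From mathcomp Require Export all_classical all_reals all_analysis.
Set Implicit Arguments.
Unset Strict Implicit.
Unset Printing Implicit Defensive.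
Import Order.TTheory GRing.Theory Num.Theory.
Local Open Scope ring_scope.
Local Open Scope complex_scope.

(* Moebius function on the positive integers, with the junk value 0 at 0
   (0 must be excluded explicitly, since primes 0 = [::]). *)
Definition mobius (n : nat) : int :=
  if (0 < n)%N && all (fun p => logn p n == 1%N) (primes n)
  then (-1) ^+ size (primes n) else 0.

(* exp(2 pi i x), written with Euler's formula because the libraries
   have no complex exponential. *)
Definition expi2pi (R : realType) (x : R) : R[i] :=
  cos (2 * pi * x) +i* sin (2 * pi * x).

Definition sqfree_expsum (R : realType) (N : nat) (alpha : R) : R[i] :=
  \sum_(1 <= n < N.+1) (mobius n ^+ 2)%:~R * expi2pi (alpha * n%:R).

(* Main.v *)
Require Import Defs.
From mathcomp Require Import all_boot all_order all_algebra complex.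
From mathcomp Require Import all_classical all_reals all_analysis.
From mathcomp Require Import zify ring lra.
Import Order.TTheory GRing.Theory Num.Theory.
Import numFieldNormedType.Exports.
Local Open Scope ring_scope.
Local Open Scope complex_scope.

(** Writing mu^2(n) as the sum of mu(d) over d^2 | n, the sum S(alpha) becomes
    a combination, with coefficients mu(d), of geometric progressions of length
    N/d^2 and ratio e(alpha d^2), of modulus at most min(N/d^2, 1/||alpha d^2||).
    Split d and this modulus dyadically and let A be the set of d in [D, 2D)
    with ||alpha d^2|| <= 1/V, where D^2 V <= N; it suffices to show
    V |A| << N^eps (N/q + q).
    If 16 D^2 <= q, the d^2 are distinct residues mod q, none of them 0, and
    alpha d^2 is close to a d^2/q, so |A| << q/V.
    If q < 16 D^2, subtract: two elements x < y of A give n = y^2 - x^2 < 4 D^2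
    with ||alpha n|| <= 2/V, and each n arises at most tau(n) << N^eps times.
    Hence |A|^2 << |A| + N^eps (D^2/q + 1)(q/V + 1), which is enough since
    D^2 V <= N and q < 16 D^2. *)

(** * The divisor bound tau(n)^k << n *)

(** With r = [a %/ k], a + 1 <= k (r + 1) <= k 2^r; take k-th powers and use k r <= a. *)
Lemma leq_succ_exp2 (k a : nat) : (0 < k)%N -> (a.+1 ^ k <= k ^ k * 2 ^ a)%N.
Proof.
move=> k0; have ak : (a < k * 2 ^ (a %/ k))%N.
  rewrite [in X in (X < _)%N](divn_eq a k).
  have r := ltn_pmod a k0.
  have : (a %/ k < 2 ^ (a %/ k))%N by exact: ltn_expl.
  nia.
have : (a.+1 ^ k <= (k * 2 ^ (a %/ k)) ^ k)%N by rewrite leq_exp2r.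
move=> /leq_trans; apply; rewrite expnMn -expnM leq_mul2l leq_exp2l //.
by rewrite leq_trunc_div orbT.
Qed.

(** A divisor d of m n is the product of gcd(d, m), which divides m, and d / gcd(d, m), which
    divides n. *)
Lemma size_divisorsM (m n : nat) : (0 < m)%N -> (0 < n)%N ->
  (size (divisors (m * n)) <= size (divisors m) * size (divisors n))%N.
Proof.
move=> m0 n0.
rewrite -(size_allpairs (fun x y => (x * y)%N)).
apply: uniq_leq_size; first exact: divisors_uniq.
move=> d; rewrite -dvdn_divisors ?muln_gt0 ?m0 // => dmn.
apply/allpairsP; exists (gcdn d m, d %/ gcdn d m)%N.
have g0 : (0 < gcdn d m)%N by rewrite gcdn_gt0 m0 orbT.
rewrite -!dvdn_divisors //= dvdn_gcdr mulnC divnK ?dvdn_gcdl //; split=> //.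
rewrite -(@dvdn_pmul2r (gcdn d m)) // divnK ?dvdn_gcdl //.
by rewrite muln_gcdr dvdn_gcd dvdn_mull // mulnC.
Qed.

Lemma size_divisors_pfactor (p a : nat) : prime p ->
  (size (divisors (p ^ a)) <= a.+1)%N.
Proof.
move=> pp; rewrite -[X in (_ <= X)%N](size_iota 0 a.+1).
rewrite -[X in (_ <= X)%N](size_map (expn p)).
apply: uniq_leq_size; first exact: divisors_uniq.
move=> d; rewrite -dvdn_divisors ?expn_gt0 ?prime_gt0 //.
by move=> /(dvdn_pfactor _ _ pp)[m ma ->]; rewrite map_f // mem_iota.
Qed.

(* tau(n)^k / n is at most the product over p | n of (e_p + 1)^k / p^e_p, with
   e_p = v_p(n); the factors with p >= 2^k are at most 1, and the others, fewer
   than 2^k in number, at most k^k. *)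
Lemma divisor_bound (k : nat) : (0 < k)%N ->
  exists C : nat, forall n : nat, (0 < n)%N -> (size (divisors n) ^ k <= C * n)%N.
Proof.
move=> k0; set c := fun p => if (p < 2 ^ k)%N then (k ^ k)%N else 1%N.
have kk : (0 < k ^ k)%N by rewrite expn_gt0 k0.
have c0 p : (0 < c p)%N by rewrite /c; case: ifP.
exists (\prod_(0 <= p < 2 ^ k) c p)%N => n n0.
have tau_prod (s : seq nat) : all prime s -> 
    (size (divisors (\prod_(p <- s) p ^ logn p n)) ^ k
      <= \prod_(p <- s) (c p * p ^ logn p n))%N.
  elim: s => [|p s IH] /=; first by rewrite !big_nil /= exp1n.
  case/andP=> pp ss; rewrite !big_cons.
  have p0 : (0 < p ^ logn p n)%N by rewrite expn_gt0 prime_gt0.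
  have P0 : (0 < \prod_(j <- s) j ^ logn j n)%N.
    rewrite big_seq; apply: prodn_cond_gt0 => i /(allP ss) ip.
    by rewrite expn_gt0 prime_gt0.
  have := size_divisorsM _ _ p0 P0; rewrite -(leq_exp2r _ _ k0) => /leq_trans.
  apply; rewrite expnMn leq_mul ?IH //.
  have := size_divisors_pfactor p (logn p n) pp.
  rewrite -(leq_exp2r _ _ k0) => /leq_trans; apply.
  rewrite /c; case: ltnP => hp.
    apply: leq_trans (leq_succ_exp2 _ _ k0) _.
    rewrite leq_mul2l; apply/orP; right.
    by have [->//|l0] := posnP (logn p n); rewrite leq_exp2r // prime_gt1.
  (* For p >= 2^k and l = [logn p n]: (l + 1)^k <= (2^l)^k = (2^k)^l <= p^l. *)
  rewrite mul1n; apply: (@leq_trans ((2 ^ k) ^ logn p n)%N).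
    by rewrite -expnM mulnC expnM leq_exp2r // ltn_expl.
  by have [->//|l0] := posnP (logn p n); rewrite leq_exp2r.
have nE : n = (\prod_(p <- primes n) p ^ logn p n)%N.
  by rewrite {1}(prod_prime_decomp n0) prime_decompE big_map.
rewrite {1}nE; apply: leq_trans (tau_prod _ _) _.
  by apply/allP=> p; rewrite mem_primes => /and3P[].
rewrite big_split /= -nE leq_mul2r; apply/orP; right.
rewrite (bigID (fun p => p < 2 ^ k)%N) /= [X in (_ * X)%N]big1 ?muln1; last first.
  by move=> p; rewrite -leqNgt /c ltnNge => ->.
rewrite -big_filter; set s := [seq x <- _ | _].
have us : uniq s by rewrite filter_uniq // primes_uniq.
(* Each [c p] is at least 1, so the product over the primes p | n below 2^k is at most the product
   over all p < 2^k, which does not depend on n. *)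
rewrite (perm_big [seq x <- index_iota 0 (2 ^ k) | x \in s]) /=; last first.
  apply: uniq_perm => //; first by rewrite filter_uniq // iota_uniq.
  move=> p; rewrite [RHS]mem_filter mem_index_iota /=.
  by have [|] := boolP (p \in s) => //; rewrite mem_filter => /andP[].
rewrite big_filter [X in (_ <= X)%N](bigID [in s]) /=.
by rewrite leq_pmulr // prodn_cond_gt0.
Qed.

(** * The identity mu^2(n) = sum of mu(d) over d^2 | n *)

Lemma mobius_prime_mul (p d : nat) : prime p -> ~~ (p %| d)%N ->
  mobius (p * d) = - mobius d.
Proof.
move=> pp pd; have p0 := prime_gt0 pp.
have d0 : (0 < d)%N by case: d pd => //; rewrite dvdn0.
rewrite /mobius muln_gt0 p0 d0 /=.
have pP : perm_eq (primes (p * d)) (p :: primes d).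
  apply: uniq_perm; rewrite ?primes_uniq //=.
    by rewrite primes_uniq andbT mem_primes pp d0.
  by move=> x; rewrite primesM // primes_prime // !inE.
rewrite (perm_all _ pP) (perm_size pP) /= lognM // logn_prime // eqxx.
have /eqP -> : logn p d == 0%N.
  by rewrite -leqn0 leqNgt logn_gt0 mem_primes pp d0.
rewrite addn0 eqxx /=.
rewrite (@eq_in_all _ _ (fun x => logn x d == 1%N)); last first.
  move=> x /=; rewrite mem_primes => /and3P[xp _ xd].
  rewrite lognM // logn_prime //.
  by have [xE|] := eqVneq p x; first by rewrite xE xd in pd.
by case: ifP; rewrite ?exprS ?mulN1r ?oppr0.
Qed.

Lemma mobius_eq0 (p n : nat) : prime p -> (p ^ 2 %| n)%N -> mobius n = 0.
Proof.
move=> pp pn; rewrite /mobius; case: ifP => // /andP[n0 /allP al].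
have l2 : (1 < logn p n)%N by rewrite -pfactor_dvdn.
have := al p; rewrite mem_primes pp n0 (dvdn_trans _ pn) ?dvdn_exp //.
by move=> /(_ isT) /eqP l1; rewrite l1 in l2.
Qed.

(* If p^2 | n with p prime, then d <-> p d (p not dividing d) pairs the
   squarefree d with d^2 | n, and mu changes sign. *)
Lemma sum_mobius_square (N n : nat) : (0 < n)%N -> (n <= N)%N ->
  \sum_(1 <= d < N.+1 | (d ^ 2 %| n)%N) mobius d = mobius n ^+ 2.
Proof.
move=> n0 nN.
have [/allP al|/allPn[p]] := boolP (all (fun p => logn p n == 1%N) (primes n)).
  have -> : mobius n ^+ 2 = 1.
    rewrite /mobius n0 (introT allP al) /= -exprM mulnC exprM.
    by rewrite expr2 mulN1r opprK expr1n.
  (* Only d = 1 contributes: a prime factor p of some d > 1 would give p^2 | n, against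
     [logn p n == 1]. *)
  rewrite big_ltn_cond ?ltnS ?(leq_trans n0) //.
  rewrite (_ : (1 ^ 2 %| n)%N = true); last exact: dvd1n.
  rewrite big_nat_cond big1 ?addr0 //.
  move=> d /andP[/andP[d1 _] dn]; exfalso.
  have pp := pdiv_prime d1; have pd := pdiv_dvd d.
  set p := pdiv d in pp pd.
  have p2 : (p ^ 2 %| n)%N by apply: dvdn_trans dn; rewrite dvdn_exp2r.
  have l2 : (1 < logn p n)%N by rewrite -pfactor_dvdn.
  have := al p; rewrite mem_primes pp n0 (dvdn_trans _ p2) ?dvdn_exp //.
  by move=> /(_ isT) /eqP l1; rewrite l1 in l2.
rewrite mem_primes => /and3P[pp _ pn] l1.
have p2 : (p ^ 2 %| n)%N.
  rewrite pfactor_dvdn //; move: l1.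
  have : (0 < logn p n)%N by rewrite logn_gt0 mem_primes pp n0.
  lia.
rewrite (mobius_eq0 _ _ pp p2) expr0n /= (bigID (fun d => p %| d)%N) /=.
have p0 := prime_gt0 pp; have p1 := prime_gt1 pp.
have -> : \sum_(1 <= d < N.+1 | (d ^ 2 %| n)%N && (p %| d)%N) mobius d =
   \sum_(1 <= d < N.+1 | (d ^ 2 %| n)%N && ~~ (p %| d)%N) mobius (p * d).
  rewrite -[LHS]big_filter -[RHS]big_filter.
  rewrite -[RHS](big_map (fun d => p * d)%N predT mobius).
  (* Multiples of p^2 drop out, since [mobius] is 0 there; the other multiples of p are the p e with
     p not dividing e. *)
  rewrite (bigID (fun d => p ^ 2 %| d)%N) /= big1 ?add0r; last first.
    by move=> d /(mobius_eq0 _ _ pp).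
  rewrite -big_filter; apply: perm_big; apply: uniq_perm.
  - by rewrite !filter_uniq // iota_uniq.
  - rewrite map_inj_uniq ?filter_uniq ?iota_uniq // => x y /eqP.
    by rewrite eqn_pmul2l // => /eqP.
  move=> d; rewrite !mem_filter mem_index_iota.
  apply/idP/mapP => [/and4P[pd /andP[dn /dvdnP[e de]] d0 dN]|[e]].
    exists e; last by rewrite mulnC.
    have pe : ~~ (p %| e)%N.
      by apply: contra pd => pe; rewrite de dvdn_mul.
    rewrite mem_filter mem_index_iota pe (dvdn_trans _ dn) /=; last first.
      by rewrite dvdn_exp2r // de dvdn_mulr.
    by move: d0 dN; rewrite de; nia.
  rewrite mem_filter mem_index_iota => /and3P[/andP[en pe] e0 eN] ->.
  have pen : ((p * e) ^ 2 %| n)%N.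
    rewrite expnMn Gauss_dvd ?p2 //.
    by rewrite coprimeXl // coprimeXr // prime_coprime.
  have pe2 : ~~ (p ^ 2 %| p * e)%N by rewrite expnS dvdn_pmul2l // expn1.
  have pe0 : (0 < p * e)%N by rewrite muln_gt0 p0.
  rewrite pe2 pen dvdn_mulr //= pe0 ltnS (leq_trans _ nN) //.
  by rewrite (leq_trans _ (dvdn_leq n0 pen)) // -[X in (X <= _)%N]expn1 leq_pexp2l.
rewrite -big_split big1 //= => d /andP[_ pd].
by rewrite mobius_prime_mul // addNr.
Qed.

(** * Counting the n with alpha n close to an integer *)

(** This is ||x|| <= [delta], with ||x|| the distance to the nearest integer; it is boolean so as to
    serve in [count] and in filters. *)
Definition near_int (R : realType) (delta x : R) : bool :=
  `[< exists b : int, `|x - b%:~R| <= delta >].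

Lemma near_intP (R : realType) (delta x : R) :
  reflect (exists b : int, `|x - b%:~R| <= delta) (near_int R delta x).
Proof. exact: asboolP. Qed.

Lemma near_intB (R : realType) (d1 d2 x y : R) :
  near_int R d1 x -> near_int R d2 y -> near_int R (d1 + d2) (x - y).
Proof.
move=> /near_intP[b hb] /near_intP[c hc]; apply/near_intP; exists (b - c).
rewrite rmorphB /= (_ : x - y - _ = (x - b%:~R) - (y - c%:~R)); last by ring.
by rewrite (le_trans (ler_normB _ _)) // lerD.
Qed.

(** Adding floor(y + r) to c gives floor(y + r + c), which lies between 0 and floor(2 r). *)
Lemma size_int_interval (R : realType) (s : seq int) (y r : R) : uniq s ->
  0 <= r -> {in s, forall c, `|y + c%:~R| <= r} -> (size s)%:R <= 2 * r + 1.
Proof.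
move=> us r0 hs; pose f (c : int) := absz (c + Num.floor (y + r)).
have fE c : c \in s -> (f c)%:Z = Num.floor (y + r + c%:~R).
  move=> /hs; rewrite ler_norml => /andP[h1 h2].
  have flD : Num.floor (y + r + c%:~R) = c + Num.floor (y + r).
    by rewrite (@floorDrz _ (y + r)) ?intr_int // intrKfloor addrC.
  rewrite flD /f gez0_abs // -flD.
  by rewrite floor_ge0; lra.
have uf : uniq (map f s).
  rewrite map_inj_in_uniq // => c d cs ds /(congr1 Posz).
  by rewrite !fE // !(@floorDrz _ (y + r)) ?intr_int // !intrKfloor => /addrI.
have : (size (map f s) <= size (iota 0 (absz (Num.floor (2 * r))).+1))%N.
  apply: uniq_leq_size => // n /mapP[c cs ->].
  have f0 : (0 <= Num.floor (2 * r)) by rewrite floor_ge0; lra.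
  rewrite mem_iota /= add0n ltnS -lez_nat fE // gez0_abs //.
  by apply: le_floor; have := hs c cs; rewrite ler_norml => /andP[_]; lra.
rewrite size_map size_iota -(ler_nat R) => /le_trans; apply.
rewrite -natr1 lerD2r -[X in X <= _]/((Posz (absz (Num.floor (2 * r))))%:~R).
rewrite gez0_abs ?floor_le //.
by rewrite floor_ge0; lra.
Qed.

(* If b is the integer close to alpha n, then n |-> a n - b q is injective on a
   block of length q and takes its values in a real interval of length
   2 (delta q + 1). *)
Lemma count_near_int_block (R : realType) (alpha : R) (a : int) (q : nat)
    (delta : R) (n0 : nat) :
  (0 < q)%N -> coprimez a q -> `|alpha * q%:R - a%:~R| <= q%:R^-1 -> 0 <= delta ->
  (count (fun n => near_int R delta (alpha * n%:R)) (iota n0 q))%:R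
    <= 2 * (delta * q%:R) + 3.
Proof.
move=> q0 caq haq d0; set P := fun n => _.
have qR : 0 < q%:R :> R by rewrite ltr0n.
have /boolp.choice[b hb] : forall n, exists c : int,
    P n -> `|alpha * n%:R - c%:~R| <= delta.
  move=> n.
  have [/near_intP[c hc]|] := boolP (P n); first by exists c.
  by exists 0.
pose c n := a * n%:Z - b n * q%:Z.
have us : uniq (map c [seq n <- iota n0 q | P n]).
  rewrite map_inj_in_uniq ?filter_uniq ?iota_uniq // => m n.
  rewrite !mem_filter !mem_iota => /andP[_ hm] /andP[_ hn] hc.
  have : (q%:Z %| m%:Z - n%:Z)%Z.
    rewrite -(@Gauss_dvdzr _ a); last by rewrite coprimez_sym.
    apply/dvdzP; exists (b m - b n); move: hc; rewrite /c; lia.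
  case/dvdzP=> k hk; have [k0|[k1|k1]] : k = 0 \/ (1 <= k \/ k <= -1) by lia.
  - by move: hk; rewrite k0 mul0r; lia.
  - by have : q%:Z <= k * q%:Z; [rewrite ler_peMl|lia].
  - by have : q%:Z <= - k * q%:Z; [rewrite ler_peMl //; lia|lia].
rewrite -size_filter -(size_map c) (_ : 2 * _ + 3 = 2 * (delta * q%:R + 1) + 1);
  last by ring.
apply: (size_int_interval _ _ ((alpha * q%:R - a%:~R) * n0%:R)) => //.
  by rewrite addr_ge0 // mulr_ge0 // ltW.
move=> e /mapP[n]; rewrite mem_filter mem_iota => /andP[/hb hn /andP[n0n nq]] ->.
(* On the right, the first term is at most [delta] q, and the second at most 1 because n - n0 <= q;
   hence the radius [delta] q + 1. *)
have -> : (alpha * q%:R - a%:~R) * n0%:R + (c n)%:~R =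
   (alpha * n%:R - (b n)%:~R) * q%:R - (alpha * q%:R - a%:~R) * (n - n0)%:R.
  rewrite /c natrB // rmorphB !rmorphM /=; ring.
apply: (le_trans (ler_normB _ _)); rewrite !normrM !normr_nat lerD //.
  by rewrite ler_pM2r.
apply: (@le_trans _ _ (q%:R^-1 * q%:R)); last by rewrite mulVf ?gt_eqF.
by rewrite ler_pM // ler_nat leq_subLR ltnW.
Qed.

Lemma count_near_int (R : realType) (alpha : R) (a : int) (q : nat)
    (delta : R) (K : nat) :
  (0 < q)%N -> coprimez a q -> `|alpha * q%:R - a%:~R| <= q%:R^-1 -> 0 <= delta ->
  (count (fun n => near_int R delta (alpha * n%:R)) (iota 0 (K * q)))%:R
    <= K%:R * (2 * (delta * q%:R) + 3).
Proof.
move=> q0 caq haq d0; elim: K => [|K IH]; first by rewrite mul0n mul0r.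
rewrite mulSnr iotaD count_cat natrD -natr1 mulrDl mul1r lerD //.
exact: (count_near_int_block _ _ a).
Qed.

(** * Level sets: the d in [D, 2D) with alpha d^2 close to an integer *)

(** The integer a d^2 - b q is nonzero, since q does not divide d^2, and it differs from (alpha d^2
    - b) q by at most 1/4. The bound serves to absorb the constant 3 of the block count. *)
Lemma near_int_sqr_small (R : realType) (alpha : R) (a : int) (q d : nat) (delta : R) :
  (0 < q)%N -> coprimez a q -> `|alpha * q%:R - a%:~R| <= q%:R^-1 ->
  (0 < d)%N -> (4 * d ^ 2 < q)%N -> near_int R delta (alpha * (d ^ 2)%:R) ->
  3 <= 4 * (delta * q%:R).
Proof.
move=> q0 caq haq d0 dq /near_intP[b hb].
have qR : 0 < q%:R :> R by rewrite ltr0n.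
have h1 : 1 <= `|(a * (d ^ 2)%:Z - b * q%:Z)%:~R| :> R.
  rewrite -intr_norm ler1z -gtz0_ge1 normr_gt0 subr_eq0; apply/eqP => hE.
  have : (q%:Z %| (d ^ 2)%:Z)%Z.
    rewrite -(@Gauss_dvdzr _ a); last by rewrite coprimez_sym.
    by apply/dvdzP; exists b.
  rewrite /dvdz /= => /dvdn_leq; rewrite expn_gt0 d0 => /(_ isT); lia.
have h2 : `|(alpha * (d ^ 2)%:R - b%:~R) * q%:R| <= delta * q%:R.
  by rewrite normrM normr_nat ler_pM2r.
have h3 : `|(alpha * q%:R - a%:~R) * (d ^ 2)%:R| <= 1 / 4.
  rewrite normrM normr_nat; apply: (@le_trans _ _ (q%:R^-1 * (q%:R / 4))).
    rewrite ler_pM // ler_pdivlMr // -natrM ler_nat mulnC; exact: ltnW.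
  by rewrite mulrA mulVf ?gt_eqF.
have hE : (a * (d ^ 2)%:Z - b * q%:Z)%:~R =
  (alpha * (d ^ 2)%:R - b%:~R) * q%:R - (alpha * q%:R - a%:~R) * (d ^ 2)%:R :> R.
  rewrite rmorphB !rmorphM /=; ring.
move: h1; rewrite hE => /le_trans/(_ (le_trans (ler_normB _ _) (lerD h2 h3))).
lra.
Qed.

(* An ordered pair x <> y is recovered from (|x^2 - y^2|, |x - y|) and the sign
   of x - y, and |x - y| divides |x^2 - y^2|. *)
Lemma pair_count_sqr (T : nat) (s t : seq nat) : uniq s ->
  {in s &, forall x y, (x < y)%N -> (y ^ 2 - x ^ 2)%N \in t} ->
  {in t, forall n, (size (divisors n) <= T)%N} ->
  (size s ^ 2 <= size s + 2 * (T * size t))%N.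
Proof.
move=> us st tT.
pose Q := [seq (x, y) | x <- s, y <- s].
have uQ : uniq Q by rewrite allpairs_uniq // => -[x y] [x' y'].
have -> : (size s ^ 2 = size Q)%N by rewrite size_allpairs mulnn.
rewrite -(count_predC (fun p => p.1 == p.2) Q) leq_add //.
  rewrite -size_filter -(size_map fst); apply: uniq_leq_size.
    rewrite map_inj_in_uniq ?filter_uniq // => -[x y] [x' y'].
    by rewrite !mem_filter /= => /andP[/eqP <- _] /andP[/eqP <- _] ->.
  move=> e /mapP[p]; rewrite mem_filter => /andP[_ /allpairsP[[x y] /= [xs _ ->]]] ->.
  by [].
pose f (p : nat * nat) : nat * (nat * bool) :=
  if (p.1 < p.2)%N then ((p.2 ^ 2 - p.1 ^ 2)%N, ((p.2 - p.1)%N, true))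
  else ((p.1 ^ 2 - p.2 ^ 2)%N, ((p.1 - p.2)%N, false)).
pose B := [seq (n, ub) | n <- t,
  ub <- [seq (u, b) | u <- divisors n, b <- [:: true; false]]].
have sB : (size B <= 2 * (T * size t))%N.
  rewrite size_allpairs_dep (eq_map (fun n => size_allpairs _ _ _)).
  elim: t tT {st B} => // n t IH tT /=.
  rewrite (mulnS T) mulnDr leq_add ?IH //.
    by rewrite mulnC leq_mul2l tT ?mem_head.
  by move=> m mt; apply: tT; rewrite inE mt orbT.
apply: leq_trans sB; rewrite -size_filter -(size_map f); apply: uniq_leq_size.
  rewrite map_inj_in_uniq ?filter_uniq // => -[x y] [x' y'].
  rewrite !mem_filter /= => /andP[xy _] /andP[xy' _]; rewrite /f /=.
  case: ltnP => h1; case: ltnP => h2 // [e1 e2].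
    by congr pair; nia.
  by congr pair; nia.
move=> e /mapP[p]; rewrite mem_filter /=.
case/andP=> xy /allpairsP[[x y] /= [xs ys pE]] ->.
rewrite {}pE /= in xy *; rewrite /f /=.
have key u v : u \in s -> v \in s -> (u < v)%N ->
    ((v ^ 2 - u ^ 2)%N \in t) && ((v - u)%N \in divisors (v ^ 2 - u ^ 2)).
  move=> us' vs uv; rewrite st // -dvdn_divisors; last by rewrite subn_gt0 ltn_sqr.
  by rewrite subn_sqr dvdn_mulr.
case: ltnP => h.
  have /andP[k1 k2] := key x y xs ys h.
  by apply/allpairsPdep; exists (y ^ 2 - x ^ 2)%N, ((y - x)%N, true); split=> //;
     apply/allpairsP; exists ((y - x)%N, true).
have {}h : (y < x)%N by rewrite ltn_neqAle eq_sym xy.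
have /andP[k1 k2] := key y x ys xs h.
by apply/allpairsPdep; exists (x ^ 2 - y ^ 2)%N, ((x - y)%N, false); split=> //;
   apply/allpairsP; exists ((x - y)%N, false).
Qed.

Lemma level_set_small (R : realType) (alpha : R) (a : int) (q D V : nat) :
  (0 < q)%N -> coprimez a q -> `|alpha * q%:R - a%:~R| <= q%:R^-1 ->
  (0 < D)%N -> (0 < V)%N -> (16 * D ^ 2 <= q)%N ->
  V%:R * (count (fun d => near_int R V%:R^-1 (alpha * (d ^ 2)%:R)) (iota D D))%:R
    <= 6 * q%:R :> R.
Proof.
move=> q0 caq haq D0 V0 Dq; rewrite -size_filter; set s := [seq _ <- _ | _].
have vR : 0 < V%:R :> R by rewrite ltr0n.
have i0 : 0 <= V%:R^-1 :> R by rewrite invr_ge0 ltW.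
have sD d : d \in s ->
    [/\ near_int R V%:R^-1 (alpha * (d ^ 2)%:R), (0 < d)%N & (4 * d ^ 2 < q)%N].
  by rewrite mem_filter mem_iota => /andP[nd /andP[Dd d2]]; split=> //; nia.
(* An empty set is trivial; otherwise a member d yields 3 <= 4 q/V, which turns the block bound 2
   q/V + 3 into 6 q/V. *)
case sE : s => [|d s'] /=; first by rewrite mulr0 mulr_ge0.
have ds : d \in s by rewrite sE mem_head.
have [nd d0 dq] := sD d ds.
have qV := near_int_sqr_small _ _ _ _ _ _ q0 caq haq d0 dq nd.
have sz : (size s <= count (fun n => near_int R V%:R^-1 (alpha * n%:R)) (iota 0 q))%N.
  rewrite -size_filter -(size_map (expn^~ 2)); apply: uniq_leq_size.
    rewrite map_inj_uniq ?filter_uniq ?iota_uniq // => x y /eqP.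
    by rewrite eqn_sqr => /eqP.
  move=> e /mapP[x xs ->]; have [nx x0 xq] := sD x xs.
  by rewrite mem_filter nx mem_iota /=; nia.
have := count_near_int_block _ _ _ _ _ 0 q0 caq haq i0.
move: sz; rewrite -(ler_nat R) sE => sz; move=> /(le_trans sz) /= sz2.
rewrite mulrC -ler_pdivlMr // -mulrA; apply: (le_trans sz2).
by move: qV; rewrite [_^-1 * _]mulrC; lra.
Qed.

(* With z = v n and Y = X + q, the hypotheses give
   z^2 <= 16 Y z + 1920 T Y^2. *)
Lemma level_set_arith (F : realFieldType) (n m T K q v X D2 : F) :
  1 <= T -> 0 < q -> 0 < v -> 0 <= X -> 0 <= K -> 0 <= m -> 0 <= n ->
  n ^+ 2 <= n + 2 * (T * m) -> m <= K * (4 * (q / v) + 3) ->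
  q <= 16 * D2 -> D2 * v <= X * q -> K * q <= 20 * D2 ->
  v * n <= 64 * T * (X + q).
Proof.
move=> T1 q0 v0 X0 K0 m0 n0 nm mK qD Dv KD.
have vX : v <= 16 * X by rewrite -(ler_pM2r q0); nra.
(* v^2 m <= K v (4 q + 3 v) <= 20 X (4 q + 3 v), and v <= 16 X. *)
have vm : v ^+ 2 * m <= 960 * (X + q) ^+ 2.
  have h1 : v ^+ 2 * m <= K * (4 * q * v + 3 * v ^+ 2).
    apply: (le_trans (ler_wpM2l (sqr_ge0 v) mK)).
    by rewrite le_eqVlt; apply/orP; left; apply/eqP; field; rewrite gt_eqF.
  have h2 : K * v <= 20 * X by rewrite -(ler_pM2r q0); nra.
  have h3 : K * v * (4 * q + 3 * v) <= 20 * X * (4 * q + 3 * v).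
    by apply: ler_wpM2r => //; nra.
  have h4 : X * v <= X * (16 * X) by apply: ler_wpM2l.
  have h5 : 0 <= X * q by rewrite mulr_ge0 // ltW.
  nra.
set Y := X + q in vm *; have Y0 : 0 < Y by rewrite /Y; lra.
set z := v * n; have z0 : 0 <= z by rewrite mulr_ge0 // ltW.
have zz : z ^+ 2 <= 16 * Y * z + 1920 * T * Y ^+ 2.
  have h1 : z ^+ 2 <= v * z + 2 * T * (v ^+ 2 * m).
    have := ler_wpM2l (sqr_ge0 v) nm; rewrite /z; nra.
  have h2 : v * z <= 16 * Y * z by apply: ler_wpM2r => //; rewrite /Y; lra.
  have h3 : T * (v ^+ 2 * m) <= T * (960 * Y ^+ 2) by apply: ler_wpM2l => //; lra.
  nra.
(* If z > 64 T Y, then 1920 T Y^2 < 30 T Y z and 16 Y z <= 16 T Y z, so z^2 < 46 T Y z, whereas z^2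
   >= 64 T Y z. *)
rewrite leNgt; apply/negP => zT.
have TY : Y <= T * Y by rewrite ler_peMl // ltW.
have h1 : 64 * (T * Y) * z <= z * z by apply: ler_wpM2r => //; nra.
have h2 : Y * z <= T * Y * z by apply: ler_wpM2r.
have h3 : T * Y * (64 * Y) < T * Y * z by rewrite ltr_pM2l; nra.
nra.
Qed.

Lemma level_set_large (R : realType) (alpha : R) (a : int) (q N T D V : nat) :
  (0 < q)%N -> coprimez a q -> `|alpha * q%:R - a%:~R| <= q%:R^-1 ->
  (0 < T)%N -> (forall n, (0 < n <= 4 * N)%N -> (size (divisors n) <= T)%N) ->
  (0 < D)%N -> (0 < V)%N -> (q <= 16 * D ^ 2)%N -> (D ^ 2 * V <= N)%N ->
  V%:R * (count (fun d => near_int R V%:R^-1 (alpha * (d ^ 2)%:R)) (iota D D))%:R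
    <= 64 * T%:R * (N%:R / q%:R + q%:R) :> R.
Proof.
move=> q0 caq haq T0 tauT D0 V0 Dq DV; rewrite -size_filter; set s := [seq _ <- _ | _].
have vR : 0 < V%:R :> R by rewrite ltr0n.
have qR : 0 < q%:R :> R by rewrite ltr0n.
have i0 : 0 <= V%:R^-1 + V%:R^-1 :> R by rewrite addr_ge0 // invr_ge0 ltW.
(* [K] blocks of length q cover [0, 4 D^2), where all the differences y^2 - x^2 lie; as q <= 16 D^2,
   [K] q <= 4 D^2 + q <= 20 D^2. *)
pose K := ((4 * D ^ 2) %/ q).+1.
pose good n := near_int R (V%:R^-1 + V%:R^-1) (alpha * n%:R).
pose t := [seq n <- iota 0 (K * q) | (0 < n < 4 * D ^ 2)%N && good n].
have sz_t : (size t)%:R <= K%:R * (4 * (q%:R / V%:R) + 3) :> R.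
  have := count_near_int _ _ _ _ _ K q0 caq haq i0.
  rewrite (_ : 2 * _ = 4 * (q%:R / V%:R)); last by ring.
  apply: le_trans; rewrite ler_nat size_filter; apply: sub_count => n.
  by case/andP.
have us : uniq s by rewrite filter_uniq ?iota_uniq.
have pairs : {in s &, forall x y, (x < y)%N -> (y ^ 2 - x ^ 2)%N \in t}.
  move=> x y; rewrite !mem_filter !mem_iota.
  move=> /andP[nx /andP[Dx xD]] /andP[ny /andP[Dy yD]] xy.
  have lt_sq : (x ^ 2 < y ^ 2)%N by rewrite ltn_sqr.
  have y4 : (y ^ 2 < 4 * D ^ 2)%N by nia.
  rewrite /good natrB ?(ltnW lt_sq) // mulrBr near_intB // andbT.
  have := ltn_ceil (4 * D ^ 2) q0; rewrite -/K.
  by move: lt_sq y4; move: (x ^ 2)%N (y ^ 2)%N (4 * D ^ 2)%N (K * q)%N; lia.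
have tT : {in t, forall n, (size (divisors n) <= T)%N}.
  move=> n; rewrite mem_filter => /andP[/andP[/andP[n0 n4] _] _].
  by apply: tauT; rewrite n0 /=; nia.
have := pair_count_sqr _ _ _ us pairs tT.
move: sz_t; set m := size t; set n := size s => sz_t.
rewrite -(ler_nat R) natrX natrD !natrM => nm.
have Kq : K%:R * q%:R <= 20 * D%:R ^+ 2 :> R.
  rewrite -natrX -!natrM ler_nat mulSn.
  by have := leq_trunc_div (4 * D ^ 2) q; lia.
have {}Dq : q%:R <= 16 * D%:R ^+ 2 :> R by rewrite -natrX -natrM ler_nat.
have {}DV : D%:R ^+ 2 * V%:R <= N%:R :> R by rewrite -natrX -natrM ler_nat.
have {}T0 : 1 <= T%:R :> R by rewrite ler1n.
set X : R := N%:R / q%:R.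
have NE : N%:R = X * q%:R by rewrite /X divfK ?gt_eqF.
have X0 : 0 <= X by rewrite /X divr_ge0.
rewrite NE in DV.
move: (D%:R ^+ 2 : R) Dq DV Kq => D2 Dq DV Kq.
exact: (level_set_arith _ _ m%:R T%:R K%:R _ _ _ D2).
Qed.

(** * Geometric sums of e(x m) *)

(** For y <= 1/4 the mean value theorem gives sin(pi y) = cos(c) pi y with cos(c) >= cos(pi/4) >=
    1/2 and pi >= 2; for y > 1/4, sin(pi y) > sin(pi/4) >= 1/2 >= y. *)
Lemma le_sin_pi (R : realType) (y : R) : 0 <= y <= 1 / 2 -> y <= sin (pi * y).
Proof.
move=> /andP[y0 y2]; have pi2 := pi_ge2 R.
have cos4 : cos (pi / 4) ^+ 2 = 1 / 2 :> R.
  have : cos ((pi / 4) *+ 2) = 0 :> R by rewrite -cos_pihalf; congr cos; field.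
  by rewrite cos_mulr2n; lra.
have sin4 : sin (pi / 4) ^+ 2 = 1 / 2 :> R by rewrite sin2cos2 cos4; lra.
have c0 : 0 <= cos (pi / 4) :> R by apply: cos_ge0_pihalf; apply/andP; lra.
have s0 : 0 <= sin (pi / 4) :> R by apply: sin_ge0_pi; apply/andP; lra.
have pyh : pi * y <= pi / 2 by rewrite ler_pM2l; lra.
have [y4|y4] := leP y (1 / 4).
  have py0 : 0 <= pi * y by rewrite mulr_ge0 // pi_ge0.
  have [|c] := @MVT_segment _ sin cos _ _ py0 (fun x _ => is_derive_sin x).
    exact/continuous_subspaceT/continuous_sin.
  rewrite sin0 !subr0 in_itv /= => /andP[c0' cy] ->.
  have cI : cos (pi / 4) <= cos c.
    by rewrite leNgt ltr_cos ?in_itv /= -?leNgt; [nra|apply/andP; lra|apply/andP; nra].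
  have c12 : 1 / 2 <= cos (pi / 4) :> R by nra.
  by rewrite mulrA ler_peMl //; nra.
have : sin (pi / 4) < sin (pi * y).
  have p4 : pi / 4 < pi * y by rewrite ltr_pM2l; lra.
  by rewrite ltr_sin // in_itv /=; apply/andP; lra.
nra.
Qed.

Import Normc.

Lemma normcD_le (R : realType) (x y : R[i]) : normc (x + y) <= normc x + normc y.
Proof. exact: le_normcD. Qed.

Lemma normE (R : realType) (x : R[i]) : `|x| = (normc x)%:C.
Proof. by []. Qed.

Lemma normc_sum_le (R : realType) (I : Type) (r : seq I) (F : I -> R[i]) :
  normc (\sum_(i <- r) F i) <= \sum_(i <- r) normc (F i).
Proof.
elim/big_rec2: _ => [|i y x _ h]; first by rewrite normc0.
by rewrite (le_trans (normcD_le _ _ _)) // lerD2l.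
Qed.

Lemma expi2piD (R : realType) (x y : R) : expi2pi (x + y) = expi2pi x * expi2pi y.
Proof.
rewrite /expi2pi mulrDr cosD sinD; apply/eqP; rewrite eq_complex /=.
by rewrite eqxx /= [X in _ == X]addrC; apply/eqP; congr (_ + _); rewrite mulrC.
Qed.

Lemma expi2pi0 (R : realType) : expi2pi (0 : R) = 1.
Proof. by rewrite /expi2pi mulr0 cos0 sin0. Qed.

Lemma expi2pi_int (R : realType) (b : int) : expi2pi (b%:~R : R) = 1.
Proof.
have nat1 (n : nat) : expi2pi (n%:R : R) = 1.
  elim: n => [|n IH]; first exact: expi2pi0.
  rewrite -natr1 expi2piD IH mul1r /expi2pi mulr1 mulr_natl.
  by rewrite cos2pi sin2pi.
case: b => n; first exact: nat1.
by rewrite NegzE rmorphN /= -[LHS]mulr1 -(nat1 n.+1) -expi2piD addNr expi2pi0.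
Qed.

Lemma normc_expi2pi (R : realType) (x : R) : normc (expi2pi x) = 1.
Proof. by rewrite /normc /expi2pi cos2Dsin2 sqrtr1. Qed.

Lemma normc_expsum_le (R : realType) (x : R) (M : nat) :
  normc (\sum_(1 <= m < M.+1) expi2pi (x * m%:R)) <= M%:R.
Proof.
apply: (le_trans (normc_sum_le _ _ _ _)).
rewrite (eq_bigr (fun=> 1)) => [|m _]; last exact: normc_expi2pi.
by rewrite sumr_const_nat subn1.
Qed.

(** |e(y) - 1| = 2 |sin(pi y)|. *)
Lemma normc_expi2pi_sub1_ge (R : realType) (y : R) : `|y| <= 1 / 2 ->
  2 * `|y| <= normc (expi2pi y - 1).
Proof.
move=> y2; have sy : `|y| <= `|sin (pi * y)|.
  have : `|y| <= sin (pi * `|y|) by apply: le_sin_pi; rewrite normr_ge0.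
  have [y0|y0] := ger0P y; first by move=> /le_trans; apply; exact: ler_norm.
  by rewrite mulrN sinN => /le_trans; apply; rewrite -normrN ler_norm.
rewrite /normc /expi2pi /=; rewrite -[leLHS]ger0_norm ?mulr_ge0 // -sqrtr_sqr.
apply: ler_wsqrtr.
rewrite (_ : 2 * pi * y = (pi * y) *+ 2); last by rewrite -mulrA mulr_natl.
rewrite oppr0 addr0 cos_mulr2n sin_mulr2n exprMn real_normK ?num_real //.
have : y ^+ 2 <= sin (pi * y) ^+ 2.
  by rewrite -real_normK ?num_real // -[leRHS]real_normK ?num_real // lerXn2r ?nnegrE.
have := cos2sin2 (pi * y); nra.
Qed.

(** The sum times e(x) - 1 telescopes to a difference of two numbers of modulus 1, while |e(x) - 1|
    >= 2 ||x||; so 2 v ||x|| <= 2. *)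
Lemma near_int_expsum (R : realType) (x v : R) (M : nat) : 0 < v ->
  v <= normc (\sum_(1 <= m < M.+1) expi2pi (x * m%:R)) -> near_int R v^-1 x.
Proof.
move=> v0; set S := \sum_(_ <= _ < _) _ => vS.
have tele : S * (expi2pi x - 1) = expi2pi (x * M.+1%:R) - expi2pi x.
  pose f m := expi2pi (x * m%:R).
  transitivity (f M.+1 - f 1%N); last by rewrite /f mulr1.
  rewrite -telescope_sumr // mulr_suml; apply: eq_bigr => m _.
  by rewrite mulrBr mulr1 -expi2piD /f -natr1 mulrDr mulr1.
have S2 : normc S * normc (expi2pi x - 1) <= 2.
  rewrite -normcM tele (le_trans (normcD_le _ _ _)) // normcN !normc_expi2pi; lra.
pose b := Num.floor (x + 1 / 2).
have xb : `|x - b%:~R| <= 1 / 2.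
  have := floor_itv (x + 1 / 2); rewrite -/b rmorphD /= => /andP[h1 h2].
  by rewrite ler_norml; apply/andP; lra.
apply/near_intP; exists b.
have eb : expi2pi (x - b%:~R) = expi2pi x.
  by rewrite expi2piD -rmorphN expi2pi_int mulr1.
have := normc_expi2pi_sub1_ge _ _ xb; rewrite eb => h.
rewrite -[v^-1]mul1r ler_pdivlMr //.
have := ler_pM (ltW v0) (mulr_ge0 (ler0n _ 2) (normr_ge0 _)) vS h.
lra.
Qed.

(** * Dyadic decomposition of S(alpha) *)

Lemma sum_multiples (V : nmodType) (k N : nat) (F : nat -> V) : (0 < k)%N ->
  \sum_(1 <= n < N.+1 | (k %| n)%N) F n = \sum_(1 <= m < (N %/ k).+1) F (k * m)%N.
Proof.
move=> k0; rewrite -[RHS](big_map (fun m => k * m)%N xpredT F) -[LHS]big_filter.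
apply: perm_big; apply: uniq_perm.
- by rewrite filter_uniq // iota_uniq.
- rewrite map_inj_uniq ?iota_uniq // => x y /eqP.
  by rewrite eqn_pmul2l // => /eqP.
move=> n; rewrite mem_filter mem_index_iota.
apply/idP/mapP => [/andP[/dvdnP[m ->]]|[m]].
  rewrite muln_gt0 ltnS => /andP[/andP[m0 _] mN]; exists m; last by rewrite mulnC.
  by rewrite mem_index_iota m0 ltnS leq_divRL.
rewrite mem_index_iota => /andP[m0]; rewrite ltnS leq_divRL // => mN ->.
by rewrite dvdn_mulr // muln_gt0 k0 m0 ltnS mulnC.
Qed.

Lemma sqfree_expsum_mobius (R : realType) (N : nat) (alpha : R) :
  sqfree_expsum N alpha = \sum_(1 <= d < N.+1) (mobius d)%:~R *
    \sum_(1 <= m < (N %/ d ^ 2).+1) expi2pi (alpha * (d ^ 2)%:R * m%:R).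
Proof.
pose G d n : R[i] := (mobius d)%:~R * expi2pi (alpha * n%:R).
transitivity (\sum_(1 <= n < N.+1) \sum_(1 <= d < N.+1)
    if (d ^ 2 %| n)%N then G d n else 0).
  rewrite /sqfree_expsum; apply: eq_big_nat => n /andP[n0 nN].
  by rewrite -big_mkcond -(sum_mobius_square N) // rmorph_sum mulr_suml.
rewrite exchange_big; apply: eq_big_nat => d /andP[d0 _].
rewrite -big_mkcond sum_multiples ?expn_gt0 ?d0 // mulr_sumr.
by apply: eq_bigr => m _; rewrite /G natrM mulrA.
Qed.

(** If 2^j is the largest power of 2 not exceeding v, then v < 2 * 2^j and the j-th term alone
    suffices. For v < 1 the term j = 0 does, whence the assumption on [P 0]. *)
Lemma layer_cake (R : realType) (v : R) (P : pred nat) (L : nat) : (0 < L)%N ->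
  P 0%N -> v < 2 ^+ L -> (forall j : nat, 2 ^+ j <= v -> P j) ->
  v <= 2 * \sum_(j < L) 2 ^+ j * (P j)%:R.
Proof.
move=> + P0 + Pv; elim: L => // L IH _; have [-> v1|L0 vL] := posnP L.
  by rewrite big_ord_recr big_ord0 /= P0 add0r expr0 mulr1 mulr1 -[2]expr1 ltW.
rewrite big_ord_recr /=; have [/(IH L0) h|h] := ltP v (2 ^+ L).
  have : 0 <= 2 ^+ L * (P L)%:R :> R by rewrite mulr_ge0 // exprn_ge0.
  lra.
rewrite (Pv _ h) mulr1; rewrite exprS in vL.
have : 0 <= \sum_(j < L) 2 ^+ j * (P j)%:R :> R.
  by rewrite sumr_ge0 // => j _; rewrite mulr_ge0 // exprn_ge0.
lra.
Qed.

Lemma sum_dyadic (V : nmodType) (F : nat -> V) (L : nat) :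
  \sum_(1 <= d < 2 ^ L) F d = \sum_(i < L) \sum_(d <- iota (2 ^ i) (2 ^ i)) F d.
Proof.
elim: L => [|L IH]; first by rewrite expn0 big_geq // big_ord0.
rewrite big_ord_recr /= -IH (@big_cat_nat _ _ _ (2 ^ L)) ?expn_gt0 ?leq_exp2l //=.
by rewrite /index_iota expnS mul2n -addnn addnK.
Qed.

Lemma normc_ge0 (R : realType) (x : R[i]) : 0 <= normc x.
Proof. by case: x => x y; rewrite sqrtr_ge0. Qed.

Lemma normc_mobius_le1 (R : realType) (d : nat) :
  normc ((mobius d)%:~R : R[i]) <= 1.
Proof.
rewrite -lecR -normE /mobius; case: ifP => _; last by rewrite normr0 ler01.
by rewrite rmorphXn rmorphN1 normrX normrN1 expr1n.
Qed.

(** Joins the two ranges of D. No d >= D satisfies d^2 V <= N unless D^2 V <= N, which is what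
    [level_set_large] asks for. *)
Lemma level_set_bound (R : realType) (alpha : R) (a : int) (q N T D V : nat) :
  (0 < q)%N -> coprimez a q -> `|alpha * q%:R - a%:~R| <= q%:R^-1 ->
  (0 < T)%N -> (forall n, (0 < n <= 4 * N)%N -> (size (divisors n) <= T)%N) ->
  (0 < D)%N -> (0 < V)%N ->
  V%:R * (count (fun d => (d ^ 2 * V <= N)%N && near_int R V%:R^-1 (alpha * (d ^ 2)%:R))
     (iota D D))%:R <= 64 * T%:R * (N%:R / q%:R + q%:R) :> R.
Proof.
move=> q0 caq haq T0 tauT D0 V0.
have T1 : 1 <= T%:R :> R by rewrite ler1n.
have X0 : 0 <= N%:R / q%:R :> R by rewrite divr_ge0.
have [DV|DV] := leqP (D ^ 2 * V) N; last first.
  rewrite (@eq_in_count _ _ pred0) ?count_pred0 => [|d].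
    by rewrite mulr0 mulr_ge0 ?mulr_ge0 // addr_ge0.
  rewrite mem_iota => /andP[Dd _]; apply/negbTE; rewrite negb_and -ltnNge.
  by rewrite (leq_trans DV) // leq_mul2r leq_sqr Dd orbT.
pose P d := near_int R V%:R^-1 (alpha * (d ^ 2)%:R).
apply: (@le_trans _ _ (V%:R * (count P (iota D D))%:R)).
  by rewrite ler_wpM2l // ler_nat; apply: sub_count => d /andP[].
have [Dq|/ltnW Dq] := leqP (16 * D ^ 2) q; last first.
  exact: (level_set_large _ _ a _ N).
apply: (le_trans (level_set_small _ _ _ _ _ _ q0 caq haq D0 V0 Dq)).
have := ler0n R q; nra.
Qed.

(** With N < 2^L, there are L dyadic ranges for d and L for the modulus of the inner sum. Each of
    the L^2 pairs costs 64 T (N/q + q), and [layer_cake] a factor 2. *)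
Lemma normc_sqfree_expsum_le (R : realType) (alpha : R) (a : int) (q N T : nat) :
  (0 < N)%N -> (0 < q)%N -> coprimez a q -> `|alpha * q%:R - a%:~R| <= q%:R^-1 ->
  (0 < T)%N -> (forall n, (0 < n <= 4 * N)%N -> (size (divisors n) <= T)%N) ->
  normc (sqfree_expsum N alpha) <=
    128 * (T * (trunc_log 2 N).+1 ^ 2)%:R * (N%:R / q%:R + q%:R).
Proof.
move=> N0 q0 caq haq T0 tauT; set L := (trunc_log 2 N).+1.
have NL : (N < 2 ^ L)%N by exact: trunc_log_ltn.
(* Both conditions follow from |[g d]| >= 2^j: the first by counting terms, the second by
   [near_int_expsum]. *)
pose P j d := (d ^ 2 * 2 ^ j <= N)%N && near_int R (2 ^ j)%:R^-1 (alpha * (d ^ 2)%:R).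
pose g d : R[i] := \sum_(1 <= m < (N %/ d ^ 2).+1) expi2pi (alpha * (d ^ 2)%:R * m%:R).
have g_le d : (0 < d)%N -> normc (g d) <= 2 * \sum_(j < L) 2 ^+ j * (P j d)%:R.
  move=> d0; have d20 : (0 < d ^ 2)%N by rewrite expn_gt0 d0.
  have [Nd|dN] := ltnP N (d ^ 2).
    by rewrite /g divn_small // big_geq // normc0 mulr_ge0 // sumr_ge0.
  have gM := normc_expsum_le R (alpha * (d ^ 2)%:R) (N %/ d ^ 2).
  apply: (@layer_cake _ _ (fun j => P j d)) => //.
  (* At level 0 the requirement is ||alpha d^2|| <= 1, which the floor meets. *)
  - rewrite /P muln1 dN /= invr1; apply/near_intP.
    exists (Num.floor (alpha * (d ^ 2)%:R)).
    have := floor_itv (alpha * (d ^ 2)%:R); rewrite rmorphD /= => /andP[h1 h2].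
    by rewrite ler_norml; apply/andP; lra.
  - apply: (le_lt_trans gM); rewrite -natrX ltr_nat.
    by apply: leq_ltn_trans NL; exact: leq_div.
  - move=> j vj; rewrite /P; apply/andP; split.
      by rewrite mulnC -leq_divRL // -(ler_nat R) natrX (le_trans vj).
    rewrite -natrX in vj.
    by apply: near_int_expsum vj; rewrite ltr0n expn_gt0.
have h1 : normc (sqfree_expsum N alpha) <= \sum_(1 <= d < N.+1) normc (g d).
  rewrite sqfree_expsum_mobius (le_trans (normc_sum_le _ _ _ _)) //.
  apply: ler_sum => d _; rewrite normcM ler_piMl ?normc_ge0 //.
  exact: normc_mobius_le1.
have h2 : \sum_(1 <= d < N.+1) normc (g d) <=
    \sum_(1 <= d < 2 ^ L) 2 * \sum_(j < L) 2 ^+ j * (P j d)%:R.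
  (* Extending the range of d from N to 2^L - 1 only adds nonnegative terms. *)
  rewrite [leRHS](@big_cat_nat _ _ _ N.+1) //= -[leLHS]addr0 lerD //.
    by apply: ler_sum_nat => d /andP[d0 _]; exact: g_le.
  by apply: sumr_ge0 => d _; rewrite mulr_ge0 // sumr_ge0.
apply: (le_trans h1); apply: (le_trans h2).
rewrite -mulr_sumr sum_dyadic.
pose B : R := 64 * T%:R * (N%:R / q%:R + q%:R).
have -> : 128 * (T * L ^ 2)%:R * (N%:R / q%:R + q%:R) =
    2 * \sum_(i < L) \sum_(j < L) B :> R.
  rewrite !sumr_const !card_ord /B natrM natrX; ring.
rewrite ler_wpM2l //; apply: ler_sum => i _; rewrite exchange_big /=.
apply: ler_sum => j _; rewrite -mulr_sumr.
have -> : \sum_(d <- iota (2 ^ i) (2 ^ i)) (P j d)%:R =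
    (count (P j) (iota (2 ^ i) (2 ^ i)))%:R :> R.
  by elim: iota => [|d s IH]; rewrite ?big_nil // big_cons IH /= natrD.
rewrite -natrX; apply: (level_set_bound _ _ a) => //; by rewrite expn_gt0.
Qed.

(** * Choice of the exponent k and conclusion *)

(** Let L = [(trunc_log 2 N).+1] and T the maximum of tau up to 4 N. Then T^k << N and L^k << N, so
    (T L^2)^k << N^3 <= N^(eps k) once k >= 3/eps. *)
Lemma divisors_log_bound (R : realType) (eps : R) : 0 < eps ->
  exists C : nat, forall N : nat, (0 < N)%N -> exists T : nat,
    [/\ (0 < T)%N, forall n, (0 < n <= 4 * N)%N -> (size (divisors n) <= T)%N &
      (T * (trunc_log 2 N).+1 ^ 2)%:R <= C.+1%:R * N%:R `^ eps].
Proof.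
move=> eps0.
pose k := (Num.truncn (3 / eps)).+1.
have k_eps : 3 <= eps * k%:R.
  by have := truncnS_gt (3 / eps); rewrite ltr_pdivrMr // mulrC -/k => /ltW.
have k0 : (0 < k)%N by [].
have [C0 hC0] := divisor_bound k k0.
exists (4 * C0 * (k ^ k) ^ 2)%N => N N0.
exists (\max_(1 <= n < (4 * N).+1) size (divisors n))%N.
set T := (\max_(_ <= _ < _) _)%N.
have T_ub n : (0 < n <= 4 * N)%N -> (size (divisors n) <= T)%N.
  case/andP=> n0 n4.
  apply: (@leq_bigmax_seq _ _ _ (fun n => size (divisors n)) n) => //.
  by rewrite mem_index_iota n0.
have Tk : (T ^ k <= C0 * (4 * N))%N.
  rewrite /T big_seq; elim/big_ind: _ => [|x y hx hy|n].
  - by rewrite exp0n.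
  - by rewrite /maxn; case: ifP.
  - rewrite mem_index_iota => /andP[n0 n4].
    by rewrite (leq_trans (hC0 n n0)) // leq_mul2l -ltnS n4 orbT.
split=> //.
  by apply: leq_trans (T_ub 1%N _) => //; rewrite muln_gt0.
have Lk : ((trunc_log 2 N).+1 ^ k <= k ^ k * N)%N.
  apply: leq_trans (leq_succ_exp2 _ _ k0) _.
  by rewrite leq_mul2l trunc_logP ?orbT.
set z := (T * _ ^ 2)%N.
have zk : (z ^ k <= (4 * C0 * (k ^ k) ^ 2).+1 * N ^ 3)%N.
  rewrite /z expnMn -expnM mulnC [(2 * k)%N]mulnC expnM.
  have h : (((trunc_log 2 N).+1 ^ k) ^ 2 <= (k ^ k * N) ^ 2)%N by rewrite leq_sqr.
  apply: (leq_trans (leq_mul h Tk)).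
  apply: (@leq_trans (4 * C0 * (k ^ k) ^ 2 * N ^ 3)).
    rewrite eq_leq // expnMn; move: ((k ^ k) ^ 2)%N => w.
    by rewrite !expnS !expn0; ring.
  by rewrite leq_mul2r leqnSn orbT.
rewrite -(@ler_pXn2r _ k) ?nnegrE ?mulr_ge0 ?powR_ge0 //.
rewrite exprMn -natrX; move: zk; rewrite -(ler_nat R) => /le_trans; apply.
(* The constant is a successor, hence at least 1 and bounded by its own k-th power. *)
rewrite natrM ler_pM //.
  by rewrite -natrX ler_nat -[X in (X <= _)%N]expn1 leq_pexp2l.
rewrite natrX -(@powR_mulrn _ (N%:R `^ eps)) ?powR_ge0 // -powRrM -powR_mulrn //.
by rewrite ler_powR // ler1n.
Qed.

Theorem theorem3 (R : realType) (eps : R) :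
  0 < eps ->
  exists C : R, 0 < C /\
    forall (N : nat) (alpha : R) (a q : int),
      (0 < N)%N -> coprimez a q -> 1 <= q ->
      `|alpha * q%:~R - a%:~R| <= (q%:~R)^-1 ->
      `|sqfree_expsum N alpha| <=
        (C * (N%:R `^ (1 + eps) * (q%:~R)^-1 + N%:R `^ eps * q%:~R))%:C.
Proof.
move=> eps0; have [C0 hC] := divisors_log_bound R eps eps0.
exists (128 * C0.+1%:R); split; first by rewrite mulr_gt0.
move=> N alpha a [q|//] N0 caq q1 haq.
have [T [T0 tauT TL]] := hC N N0.
rewrite normE lecR.
apply: (le_trans (normc_sqfree_expsum_le _ _ _ _ _ _ N0 q1 caq haq T0 tauT)).
have NR : (N%:R : R) != 0 by rewrite pnatr_eq0 -lt0n.
(* N^(1 + eps) = N * N^eps, so N^eps factors out of the right-hand side and leaves N/q + q. *)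
rewrite powRD ?NR ?implybT // powRr1 //.
rewrite (_ : 128 * _ * (_ + _) =
    128 * (C0.+1%:R * N%:R `^ eps) * (N%:R / q%:R + q%:R)); last first.
  by rewrite -[q%:~R]/(q%:R); ring.
by rewrite ler_wpM2r ?addr_ge0 ?divr_ge0 // ler_wpM2l.
Qed.
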